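(* Let $X,Y$ be Banach spaces and let $u:\mathbb{R}_{\ge 0}\to\mathcal{L}(X;Y)$ be a function. Then the following are equivalent: (a) for each $x\in X$ there is $t_x\ge 0$ such that the orbit $u_x$ is locally bounded on $(t_x,\infty)$; (b) there is $t\ge 0$ such that for all $x\in X$ the orbit $u_x$ is locally bounded on $(t,\infty)$.
   Context: $X,Y$ are Banach spaces over the same field $\mathbb{R}$ or $\mathbb{C}$; $\mathcal{L}(X;Y)$ is the space of bounded linear operators from $X$ to $Y$; $\mathbb{R}_{\ge 0}=[0,\infty)$. No continuity or other regularity of $u$ is assumed. For $x\in X$, the orbit is the function $u_x:\mathbb{R}_{\ge 0}\to Y$, $u_x(t)=u(t)x$. A function is locally bounded on an interval $J$ if it is bounded on every compact subinterval of $J$. *)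

(* Defs.v *)
From HB Require Import structures.
From mathcomp Require Export all_boot all_order all_algebra.
From mathcomp Require Export complex.
From mathcomp Require Export all_classical all_reals all_analysis.
Set Implicit Arguments.
Unset Strict Implicit.
Unset Printing Implicit Defensive.
Export Order.TTheory GRing.Theory Num.Theory.
Export numFieldNormedType.Exports.
Local Open Scope classical_set_scope.
Local Open Scope ring_scope.

(* Norms take values in [K]. When [K = R[i]], [a <= b] means that [b - a] is a
   nonnegative real, so [C] is real as soon as [X] is nonzero. *)
Record bounded_operator (K : numFieldType) (X Y : normedModType K) :=
  BoundedOperator {
    operator_fun :> {linear X -> Y};
    operator_bounded : exists C : K, forall x, `|operator_fun x| <= C * `|x|
  }.

Definition operator_orbit (R : realType) (K : numFieldType)
    (X Y : normedModType K) (u : {nonneg R} -> bounded_operator X Y) (x : X) :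
    {nonneg R} -> Y :=
  fun t => u t x.

(* Meant for intervals [J] contained in [0, +oo[, the domain of [f]. *)
Definition locally_bounded_on (R : realType) (K : numFieldType)
    (Y : normedModType K) (J : set R) (f : {nonneg R} -> Y) : Prop :=
  forall I : set R, is_interval I -> compact I -> I `<=` J ->
    [bounded f s | s in [set s : {nonneg R} | I s%:num]].

(* Main.v *)
Require Import Defs.
Set Implicit Arguments.
Unset Strict Implicit.
Unset Printing Implicit Defensive.
Local Open Scope classical_set_scope.
Local Open Scope ring_scope.
Local Open Scope complex_scope.

(** The theorem is an instance of the condensation of singularities. If (b)
    fails, then for every natural number [n] some vector has an orbit that is
    unbounded on some compact interval [I n] contained in ]n, +oo[.
    [condensation_of_singularities] turns these countably many vectors, one for
    each [n], into a single vector [x] whose orbit is unbounded on all the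
    [I n]. This contradicts (a) for [x]: as soon as [n] exceeds [t_x], the
    interval [I n] lies in ]t_x, +oo[, where the orbit of [x] is locally bounded.

    Condensation is a Baire category argument. For each pair [(n, C)], the
    vectors with an orbit exceeding [C] somewhere on the [n]-th index set form
    an open set, because each operator is continuous, and a dense set, because a
    vector with a bounded orbit acquires an unbounded one when an arbitrarily
    small multiple of a singular vector is added to it. A point common to these
    countably many sets has an unbounded orbit on every index set.

    The real and complex cases are treated together: all that is used of the
    scalar field is that norms are dominated by natural numbers, so that bounds
    and radii can be taken in a countable set. *)

Lemma real_archimedean (R : realType) : Num.archimedean_axiom R.
Proof. by move=> x; exists (Num.bound `|x|); exact: archi_boundP. Qed.

Lemma complex_archimedean (R : realType) : Num.archimedean_axiom R[i].
Proof.
move=> z; rewrite normc_def; set r := Num.sqrt _.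
have [n rn] := real_archimedean r; exists n.
have -> : n%:R = (n%:R : R)%:C by rewrite rmorph_nat.
by rewrite ltcR (le_lt_trans (ler_norm r)).
Qed.

Lemma archimedean_invSn (K : numFieldType) (hK : Num.archimedean_axiom K)
    (e : K) : 0 < e -> exists n : nat, n.+1%:R^-1 < e.
Proof.
move=> e0; have [n] := hK e^-1; rewrite gtr0_norm ?invr_gt0// => en.
exists n; rewrite -[ltRHS]invrK ltf_pV2 ?posrE ?invr_gt0 ?ltr0n//.
by rewrite (lt_trans en)// ltr_nat.
Qed.

(** Baire's theorem over an Archimedean scalar field, real or complex. The points
    of the intersection are limits of the centers of nested closed balls, the
    [k]-th choice of a ball being made inside [F k]. The radii are of the form
    [m.+1%:R^-1], and [m] is taken at least [k], which makes the centers a Cauchy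
    sequence. *)
Lemma archimedean_baire (K : numFieldType) (hK : Num.archimedean_axiom K)
    (X : completeNormedModType K) (F : nat -> set X) :
  (forall k, open (F k)) -> (forall k, dense (F k)) -> dense (\bigcap_k F k).
Proof.
move=> Fo Fd O [x0 Ox0] Oo.
(* The pair [(x, m)] stands for the closed ball of center [x] and radius
   [m.+1%:R^-1]. *)
pose B (p : X * nat) := [set y | `|p.1 - y| <= p.2.+1%:R^-1].
have in_open (U : set X) x k : open U -> U x ->
    exists2 m, (k <= m)%N & B (x, m) `<=` U.
  move=> Uo Ux; have /nbhs_normP[e /= e0 eU] : nbhs x U by exact: open_nbhs_nbhs.
  have [m me] := archimedean_invSn hK e0.
  exists (maxn k m); first exact: leq_maxl.
  move=> y /= xy; apply: eU => /=; apply: le_lt_trans xy (le_lt_trans _ me).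
  by rewrite lef_pV2 ?posrE// ler_nat ltnS leq_maxr.
have shrink (q : nat * (X * nat)) : exists p : X * nat,
    [/\ (q.1 <= p.2)%N, B p `<=` B q.2 & B p `<=` F q.1].
  case: q => k [a n] /=.
  pose U : set X := [set y | `|a - y| < n.+1%:R^-1].
  have Uo : open U.
    rewrite (_ : U = ball a n.+1%:R^-1); last by rewrite -ball_normE.
    exact: ball_open.
  have [||b [Ub Fb]] := Fd k U; [|exact: Uo|].
    by exists a; rewrite /U/= subrr normr0 invr_gt0.
  have [m km Bm] := in_open (U `&` F k) b k (openI Uo (Fo k)) (conj Ub Fb).
  exists (b, m); split=> //= y /Bm[]//.
  by rewrite /U/B/= => /ltW.
have [f fP] := choice shrink.
have [m0 _ B0O] := in_open O x0 0%N Oo Ox0.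
pose p := fix p k := if k is j.+1 then f (j, p j) else (x0, m0).
have pS k : [/\ (k <= (p k.+1).2)%N, B (p k.+1) `<=` B (p k) &
    B (p k.+1) `<=` F k] by exact: (fP (k, p k)).
have Bmono k m : (k <= m)%N -> B (p m) `<=` B (p k).
  elim: m => [|m IH]; first by rewrite leqn0 => /eqP->.
  rewrite leq_eqVlt => /orP[/eqP->//|]; rewrite ltnS => /IH.
  by apply: subset_trans; have [] := pS m.
have Bc k m : (k <= m)%N -> `|(p k).1 - (p m).1| <= (p k).2.+1%:R^-1.
  by move=> /Bmono; apply; rewrite /B/= subrr normr0 invr_ge0.
pose a k := (p k).1.
have : cvg (a @ \oo).
  apply: cauchy_cvg; apply: cauchy_exP => e e0.
  have [n ne] := archimedean_invSn hK e0.
  exists (a n.+1), n.+1 => // m nm; rewrite -ball_normE /=.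
  apply: le_lt_trans (Bc _ _ nm) (le_lt_trans _ ne).
  by rewrite lef_pV2 ?posrE// ler_nat ltnS; have [] := pS n.
rewrite cvg_ex => -[l /cvgrPdist_lt al].
have Bl k : B (p k) l.
  (* Closed balls contain the limits of their sequences: the bound on
     [`|a k - l|] is obtained up to an arbitrary [e]. *)
  apply/ler_addgt0Pr => e e0; have [N _ aN] := al e e0.
  rewrite (le_trans (ler_distD (a (maxn k N)) _ _))// lerD//.
    by apply: Bc; exact: leq_maxl.
  by rewrite ltW// distrC; apply: aN; exact: leq_maxr.
exists l; split; first exact/B0O/(Bl 0%N).
by move=> k _; have [_ _] := pS k; apply; exact: Bl.
Qed.

(** Restricting to natural bounds makes unboundedness a countable intersection of
    conditions, as Baire's theorem requires. *)
Lemma archimedean_boundedP (K : numFieldType) (hK : Num.archimedean_axiom K)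
    (Y : normedModType K) (S : Type) (J : set S) (f : S -> Y) :
  [bounded f s | s in J] <->
  exists n : nat, forall s, J s -> `|f s| <= n%:R.
Proof.
split=> [[M [Mr MJ]]|[n fn]].
  have [n Mn] := hK M; exists n => s Js; apply: (MJ n%:R) Js.
  exact: le_lt_trans (real_ler_norm Mr) Mn.
exists n%:R; split; first exact: realn.
by move=> M nM s Js; exact: le_trans (fn s Js) (ltW nM).
Qed.

Lemma bounded_operator_continuous (K : numFieldType) (X Y : normedModType K)
    (T : bounded_operator X Y) : continuous T.
Proof.
case: T => T [C TC] /=; apply/linear_bounded_continuous/linear_boundedP.
exists `|C|; split; first exact: normr_real.
move=> M CM x; apply: le_trans (_ : `|C| * `|x| <= _); last first.
  by rewrite ler_wpM2r// ltW.
(* The constant [C] need not be real when [X] is trivial, whence [`|C|]: the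
   product [C * `|x|] is nonnegative in any case, hence equal to its norm. *)
apply: le_trans (TC x) _.
have /ger0_norm <- : 0 <= C * `|x| by exact: le_trans (TC x).
by rewrite normrM normr_id.
Qed.

(** Condensation of singularities: [x] is found in the intersection of the dense
    open sets [U (n, C)] of the vectors whose norm exceeds [C] under some
    operator indexed by [J n]. *)
Lemma condensation_of_singularities (K : numFieldType)
    (hK : Num.archimedean_axiom K) (X : completeNormedModType K)
    (Y : normedModType K) (S : Type) (u : S -> bounded_operator X Y)
    (J : nat -> set S) :
  (forall n, exists x, ~ [bounded u s x | s in J n]) ->
  exists x, forall n, ~ [bounded u s x | s in J n].
Proof.
move=> unb.
pose U (q : nat * nat) := [set x | exists2 s, J q.1 s & q.2%:R < `|u s x|].
have Uo q : open (U q).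
  rewrite openE => x [s Js sx].
  have e0 : 0 < `|u s x| - q.2%:R by rewrite subr_gt0.
  have /cvgrPdist_lt/(_ _ e0) := @bounded_operator_continuous _ _ _ (u s) x.
  apply: filterS => y xy; exists s => //.
  rewrite -[ltLHS](subKr `|u s x|) ltrBlDl -ltrBlDr.
  by apply: le_lt_trans xy; rewrite lerB_dist.
have unbU n C x : ~ [bounded u s x | s in J n] -> U (n, C) x.
  apply: contra_notP => nU; apply/(archimedean_boundedP hK); exists C => s Js.
  have [//|Cs] := real_leP (normr_real (u s x)) (realn _ C).
  by case: nU; exists s.
have Ud q : dense (U q).
  case: q => n C O [x Ox] Oo.
  have [bx|] := pselect [bounded u s x | s in J n]; last first.
    by move=> /(unbU n C) Ux; exists x.
  have [z nbz] := unb n.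
  have /nbhs_normP[e /= e0 eO] : nbhs x O by exact: open_nbhs_nbhs.
  have z1 : 0 < `|z| + 1 by rewrite ltr_wpDl.
  (* The vector [c *: z] is shorter than [e], so that [x + c *: z] stays in [O].
     Its orbit is unbounded on [J n], for otherwise the orbit of [z] would be
     bounded, as [z] is [c^-1] times the difference of [x + c *: z] and [x]. *)
  pose c := e / (`|z| + 1); have c0 : 0 < c by rewrite divr_gt0.
  exists (x + c *: z); split.
    apply: eO => /=; rewrite opprD addNKr normrN normrZ gtr0_norm//.
    by rewrite /c mulrAC ltr_pdivrMr// ltr_pM2l// ltrDl.
  apply: unbU => /(archimedean_boundedP hK)[m bxz].
  move/(archimedean_boundedP hK): bx => [k bx].
  have [N] := hK (c^-1 * (k%:R + m%:R)).
  rewrite ger0_norm ?mulr_ge0 ?invr_ge0 ?addr_ge0 ?(ltW c0)// => kmN.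
  apply/nbz/(archimedean_boundedP hK); exists N => s Js.
  apply: le_trans (ltW kmN); rewrite ler_pdivlMl//.
  rewrite -[X in X * _](gtr0_norm c0) -normrZ -linearZ/=.
  have -> : c *: z = (x + c *: z) - x by rewrite addrC addKr.
  rewrite linearB/=; apply: le_trans (ler_normB _ _) _.
  by rewrite addrC lerD ?bx ?bxz.
(* [unpickle] enumerates the pairs [(n, C)]; the default pair stands for the
   integers that encode none. *)
have [||x [_ Ux]] := archimedean_baire hK (F := fun k =>
    U (odflt (0%N, 0%N) (unpickle k))) (fun=> Uo _) (fun=> Ud _) (O := setT).
- by exists 0.
- exact: openT.
exists x => n /(archimedean_boundedP hK)[C bx].
have := Ux (pickle (n, C)) I; rewrite pickleK /= => -[s /bx/= sC].
by rewrite (le_gtF sC).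
Qed.

Theorem proposition3p3 (R : realType) (K : numFieldType)
    (hK : K = R :> numFieldType \/ K = R[i] :> numFieldType)
    (X Y : completeNormedModType K)
    (u : {nonneg R} -> bounded_operator X Y) :
  (forall x : X, exists t : {nonneg R},
      locally_bounded_on `]t%:num, +oo[ (operator_orbit u x))
  <->
  (exists t : {nonneg R}, forall x : X,
      locally_bounded_on `]t%:num, +oo[ (operator_orbit u x)).
Proof.
split=> [orb|[t orb] x]; last by exists t; exact: orb.
have arK : Num.archimedean_axiom K.
  by case: hK => ->; [exact: real_archimedean|exact: complex_archimedean].
apply: contrapT => noT.
have bad n : exists I : set R, [/\ is_interval I, compact I,
    I `<=` `]n%:R, +oo[ &
    exists x, ~ [bounded u s x | s in [set s : {nonneg R} | I s%:num]]].
  apply: contrapT => good; apply: noT; exists n%:R%:nng => x I Ii Ic In.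
  apply: contrapT => nb; apply: good; exists I; split=> //.
  by exists x.
have [I IP] := choice bad.
have [x nbx] := condensation_of_singularities arK (u := u)
  (J := fun n => [set s : {nonneg R} | I n s%:num])
  (fun n => let: And4 _ _ _ h := IP n in h).
have [t tx] := orb x; have [n tn] := real_archimedean t%:num.
have [Ii Ic In _] := IP n.
apply: (nbx n); apply: tx => // r /In /=; rewrite !in_itv/= !andbT.
by apply: lt_trans; exact: le_lt_trans (ler_norm _) tn.
Qed.
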